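(* Let $G$ be a finite simple graph on $n$ vertices. Then $Z_-(\mathcal B_L(G))=n+2Z_L(G)$ and $\gamma_{\rm gr}^t(\mathcal B_L(G))=2\gamma_{\rm gr}^L(G)$.
   Context: For $G$ on vertex set $\{1,\ldots,n\}$, $\mathcal B_L(G)$ is the bipartite graph with vertex set $\{x_1,\ldots,x_n\}\cup\{y_1,\ldots,y_n\}\cup\{z_1,\ldots,z_n\}$ and edge set $\{\{x_i,y_j\},\{x_i,z_j\}:\{i,j\}\in E(G)\}\cup\{\{x_i,y_i\}:i\in V(G)\}$. $N(x)$, $N[x]$ denote open and closed neighborhoods. A total dominating sequence is a sequence $(v_1,\ldots,v_k)$ of distinct vertices with $N(v_i)\setminus\bigcup_{j<i}N(v_j)\ne\emptyset$ for all $i$; an $L$-sequence is one with $N[v_i]\setminus\bigcup_{j<i}N(v_j)\ne\emptyset$ for all $i$; $\gamma_{\rm gr}^t$ and $\gamma_{\rm gr}^L$ are the maximum lengths of these. Zero forcing: vertices are blue or white; $Z_-(H)$ is the minimum size of an initial blue set such that repeatedly applying ''if $y\in N(x)$ and all of $N(x)$ is blue except $y$, then $y$ turns blue'' makes all vertices blue. $Z_L(G)$ is the minimum size of an initial blue set such that repeatedly applying the following makes all vertices blue: for $x\ne y$, if $y\in N(x)$ and all of $N(x)$ is blue except $y$, then $y$ turns blue; for $x=y$, if $x$ is white and all of $N(x)$ is blue, then $x$ turns blue. *)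

(* Defs.v *)
From mathcomp Require Import all_boot.

Set Implicit Arguments.
Unset Strict Implicit.
Unset Printing Implicit Defensive.

Record sgraph := SGraph {
  vertex :> finType;
  adj : rel vertex;
  adj_sym : symmetric adj;
  adj_irr : irreflexive adj
}.

Definition nbh (G : sgraph) (x : G) : {set G} := [set y | adj x y].
Definition cnbh (G : sgraph) (x : G) : {set G} := x |: nbh x.

(** * The bipartite graph B_L(G) *)

(* x_i, y_i and z_i are [inl (inl i)], [inl (inr i)] and [inr i]. *)
Definition BL_vertex (G : sgraph) : finType := (G + G + G)%type.

(* Edges oriented from the x-copy; [BL_adj] is the symmetric closure. *)
Definition BL_arc (G : sgraph) (u v : BL_vertex G) : bool :=
  match u, v with
  | inl (inl i), inl (inr j) => adj i j || (i == j)
  | inl (inl i), inr j => adj i j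
  | _, _ => false
  end.

Definition BL_adj (G : sgraph) : rel (BL_vertex G) :=
  fun u v => BL_arc u v || BL_arc v u.

Lemma BL_adj_sym (G : sgraph) : symmetric (@BL_adj G).
Proof. by move=> u v; rewrite /BL_adj orbC. Qed.

Lemma BL_adj_irr (G : sgraph) : irreflexive (@BL_adj G).
Proof. by case=> [[]|]. Qed.

Definition BL (G : sgraph) : sgraph :=
  SGraph (@BL_adj_sym G) (@BL_adj_irr G).

(** * Grundy domination numbers *)

Definition total_dominating_seq (G : sgraph) (k : nat) (s : k.-tuple G) : bool :=
  uniq s && [forall i : 'I_k,
    nbh (tnth s i) :\: \bigcup_(j < k | j < i) nbh (tnth s j) != set0].

Definition L_seq (G : sgraph) (k : nat) (s : k.-tuple G) : bool :=
  uniq s && [forall i : 'I_k,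
    cnbh (tnth s i) :\: \bigcup_(j < k | j < i) nbh (tnth s j) != set0].

(* The bound on k loses nothing: the entries of a sequence are distinct. *)
Definition gamma_gr_t (G : sgraph) : nat :=
  \max_(k < #|G|.+1 | [exists s : k.-tuple G, total_dominating_seq s]) k.

Definition gamma_gr_L (G : sgraph) : nat :=
  \max_(k < #|G|.+1 | [exists s : k.-tuple G, L_seq s]) k.

(** * Zero forcing *)

(* [rule B x y]: when B is the set of blue vertices, x turns y blue. *)
Definition color_rule (G : sgraph) := {set G} -> rel G.

(* The color of x is irrelevant here. *)
Definition skew_rule (G : sgraph) : color_rule G := fun B x y =>
  [&& y \in nbh x, y \notin B & nbh x :\ y \subset B].

Definition L_rule (G : sgraph) : color_rule G := fun B x y =>
  if x == y then (x \notin B) && (nbh x \subset B) else skew_rule B x y.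

Definition color_step (G : sgraph) (rule : color_rule G) : rel {set G} :=
  fun B B' => [exists x, exists y, rule B x y && (B' == y |: B)].

Definition forcing_set (G : sgraph) (rule : color_rule G) (S : {set G}) : bool :=
  connect (color_step rule) S setT.

Lemma forcing_setT (G : sgraph) (rule : color_rule G) : forcing_set rule setT.
Proof. exact: connect0. Qed.

(* By [forcing_setT] the argmin is over a nonempty family, so this is the
   minimum cardinality of a forcing set. *)
Definition forcing_number (G : sgraph) (rule : color_rule G) : nat :=
  #|[arg min_(S < setT | forcing_set rule S) #|S|]|.

Definition Z_skew (G : sgraph) : nat := forcing_number (@skew_rule G).
Definition Z_L (G : sgraph) : nat := forcing_number (@L_rule G).

(* Main.v *)
(** A sequence is recorded together with its footprints, as pairs (v, w) in
    which w lies in the neighborhood of v and in the open neighborhood of no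
    earlier v'.  Exchanging the two components and reversing the order
    preserves this property.  Read backwards, with w forcing v, such a
    sequence is a run of the color change rule whose initial white set is the
    set of the v's; hence the forcing number is the order of the graph minus
    the Grundy number, for both pairs of notions.  In B_L(G), the vertices x_i
    of a total dominating sequence form an L-sequence of G; exchange and
    reversal turn the other vertices into footprints by vertices x_i, so they
    also contribute at most the L-Grundy number.  Conversely an L-sequence
    of G lifts to the x-side, and appending the reversed exchange of the lift
    doubles it. *)

Require Import Defs.
From mathcomp Require Import all_boot.

Set Implicit Arguments.
Unset Strict Implicit.
Unset Printing Implicit Defensive.

Lemma nbh_sym (G : sgraph) (x y : G) : (y \in nbh x) = (x \in nbh y).
Proof. by rewrite !inE adj_sym. Qed.

(** * Sequences recorded with their footprints *)

Section Footprints.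
Variables (G : sgraph) (N : G -> {set G}).
Implicit Types p : seq (G * G).

Definition footprinted p : bool :=
  all (fun q => q.2 \in N q.1) p
  && pairwise (fun q q' => q'.2 \notin nbh q.1) p.

(* Convertible to [gamma_gr_t G] for [N := @nbh G] and to [gamma_gr_L G] for
   [N := @cnbh G]. *)
Definition grundy : nat :=
  \max_(k < #|G|.+1 | [exists s : k.-tuple G, uniq s && [forall i : 'I_k,
    N (tnth s i) :\: \bigcup_(j < k | j < i) nbh (tnth s j) != set0]]) k.

Lemma footprintedP (k : nat) (s : k.-tuple G) :
  reflect (exists2 p, footprinted p & unzip1 p = s)
    [forall i : 'I_k,
       N (tnth s i) :\: \bigcup_(j < k | j < i) nbh (tnth s j) != set0].
Proof.
apply: (iffP forallP) => [fp | [p /andP[/allP Np Pp] ps] i].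
  have {}fp i := set0Pn _ (fp i).
  pose w i := xchoose (fp i).
  have ww i : w i \in _ := xchooseP (fp i).
  exists [seq (tnth s i, w i) | i <- enum 'I_k]; last first.
    by rewrite /unzip1 -map_comp -[RHS]map_tnth_enum.
  rewrite /footprinted all_map; apply/andP; split.
    by apply/allP => i _ /=; have /setDP[] := ww i.
  rewrite pairwise_map.
  have: pairwise (relpre val ltn) (enum 'I_k).
    rewrite -(pairwise_map val) val_enum_ord -sorted_pairwise.
      exact: iota_ltn_sorted.
    exact: ltn_trans.
  apply: sub_pairwise => i j /= lt_ij.
  have /setDP[_] := ww j; apply: contra => wi; apply/bigcupP.
  by exists i.
have sz : size p = k by rewrite -(size_tuple s) -ps size_map.
pose q0 := (tnth s i, tnth s i).
have sE j : tnth s j = (nth q0 p j).1.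
  by rewrite (tnth_nth q0.1) -ps (nth_map q0) // sz.
apply/set0Pn; exists (nth q0 p i).2; rewrite inE sE Np ?mem_nth ?sz // andbT.
apply/negP => /bigcupP[j lt_ji]; rewrite sE; apply/negP.
by move/pairwiseP: Pp; apply; rewrite // inE sz.
Qed.

(** Distinctness is a separate hypothesis: for [N := @cnbh G] a vertex could occur a second time
    with itself as footprint. *)
Lemma size_footprinted_le p :
  uniq (unzip1 p) -> footprinted p -> size p <= grundy.
Proof.
move=> Up Fp; have lt_p : size p < #|G|.+1.
  by rewrite ltnS -(size_map fst) -(card_uniqP Up) max_card.
apply: (@leq_bigmax_cond _ _ _ (Ordinal lt_p)).
have sz : size (unzip1 p) == size p by rewrite size_map.
apply/existsP; exists (Tuple sz); rewrite Up /=.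
by apply/footprintedP; exists p.
Qed.

Lemma grundy_attained :
  exists p, [/\ uniq (unzip1 p), footprinted p & size p = grundy].
Proof.
have [|k] := @eq_bigmax_cond _ [pred k : 'I_#|G|.+1 |
  [exists s : k.-tuple G, uniq s && [forall i : 'I_k,
    N (tnth s i) :\: \bigcup_(j < k | j < i) nbh (tnth s j) != set0]]]
  (fun k => k : nat).
  (* The empty sequence makes the family under the maximum nonempty. *)
  apply/card_gt0P; exists ord0; apply/existsP; exists [tuple].
  by apply/forallP => -[].
move=> /existsP[s /andP[Us /footprintedP[p Fp ps]]] gk.
exists p; rewrite ps; split=> //.
by rewrite /grundy [RHS]gk -(size_tuple s) -ps size_map.
Qed.

Lemma sub_footprinted p p' : subseq p' p -> footprinted p -> footprinted p'.
Proof.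
move=> sub /andP[/allP Np Pp]; rewrite /footprinted (subseq_pairwise sub Pp).
by rewrite andbT; apply/allP => q /(mem_subseq sub); apply: Np.
Qed.

Lemma footprinted_rcons p q :
  footprinted (rcons p q) =
  [&& q.2 \in N q.1, all (fun q' => q.2 \notin nbh q'.1) p & footprinted p].
Proof.
rewrite /footprinted all_rcons pairwise_rcons -!andbA.
by congr (_ && _); rewrite andbCA.
Qed.

(** * Duality between forcing runs and footprinted sequences *)

Section Forcing.
Variable rule : color_rule G.
Hypothesis Nsym : forall x y, (y \in N x) = (x \in N y).
Hypothesis ruleE : forall B x y,
  rule B x y = [&& y \in N x, y \notin B & nbh x :\ y \subset B].

Lemma forcing_footprinted p : uniq (unzip1 p) -> footprinted p ->
  forcing_set rule (~: [set x in unzip1 p]).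
Proof.
elim/last_ind: p => [_ _|p [v w] IHp].
  by rewrite set_nil setC0; apply: connect0.
rewrite footprinted_rcons /unzip1 map_rcons rcons_uniq /=.
move=> /andP[vp Up] /and3P[wv /allP wp Fp]; apply: connect_trans (IHp Up Fp).
apply: connect1; apply/existsP; exists w; apply/existsP; exists v.
rewrite ruleE -Nsym wv !inE mem_rcons mem_head /=; apply/andP; split.
  (* A white neighbor of [w] other than [v] would be an earlier entry of the sequence, whose
     neighborhood avoids [w]. *)
  apply/subsetP => u; rewrite in_setD1 in_setC inE mem_rcons inE negb_or.
  case/andP=> -> /= uw; apply/negP => /mapP[q qp uq].
  by have := wp q qp; rewrite nbh_sym -uq uw.
apply/eqP/setP => u; rewrite !inE mem_rcons inE.
by case: eqP => // ->; rewrite vp.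
Qed.

(** The first force of a run, [w] turning [v] blue, becomes the last pair [(v, w)], after the
    sequence built from the rest of the run. *)
Lemma footprinted_forcing S : forcing_set rule S ->
  exists p, [/\ uniq (unzip1 p), footprinted p & S = ~: [set x in unzip1 p]].
Proof.
case/connectP => c; elim: c S => [|S' c IHc] S /=.
  by move=> _ <-; exists [::]; rewrite set_nil setC0.
case/andP=> /existsP[w /existsP[v /andP[]]]; rewrite ruleE.
case/and3P=> vw vS /subsetP wS /eqP SS' /IHc{}IHc /IHc[p [Up Fp S'p]].
have in_p u : (u \in unzip1 p) = (u != v) && (u \notin S).
  by move/setP/(_ u): S'p; rewrite SS' !inE -negb_or => ->; rewrite negbK.
exists (rcons p (v, w)); split.
- by rewrite /unzip1 map_rcons rcons_uniq Up in_p eqxx.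
- rewrite footprinted_rcons Fp /= Nsym vw andbT; apply/allP => q qp.
  have := map_f fst qp; rewrite in_p nbh_sym => /andP[qv]; apply: contra => qw.
  by rewrite wS // in_setD1 qv.
apply/setP => u; rewrite !inE /unzip1 map_rcons mem_rcons inE in_p negb_or.
by rewrite negb_and !negbK; case: eqP => // ->; rewrite (negPf vS).
Qed.

Lemma forcing_number_grundy : forcing_number rule + grundy = #|G|.
Proof.
have cardp p : uniq (unzip1 p) -> #|~: [set x in unzip1 p]| + size p = #|G|.
  move=> Up; rewrite -(size_map fst) -(card_uniqP Up) addnC.
  by rewrite -[in X in X + _]cardsE cardsC.
rewrite /forcing_number; case: arg_minnP => [|S fS minS].
  exact: forcing_setT.
have [p [Up Fp Sp]] := footprinted_forcing fS.
have [p' [Up' Fp' szp']] := grundy_attained.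
(* One inequality compares the minimal [S] with the complement of the longest sequence [p']; the
   other bounds the sequence [p] extracted from [S]. *)
apply/eqP; rewrite eqn_leq -{1}(cardp p' Up') -szp' leq_add2r.
rewrite minS ?forcing_footprinted //= -(cardp p Up) -Sp leq_add2l szp'.
exact: size_footprinted_le.
Qed.

End Forcing.
End Footprints.

Lemma Z_skew_grundy (G : sgraph) : Z_skew G + gamma_gr_t G = #|G|.
Proof.
by apply: (@forcing_number_grundy _ (@nbh G)) => // x y; rewrite nbh_sym.
Qed.

(** As [y] is not in [nbh y], the two cases of [L_rule] merge into one condition with [cnbh]. *)
Lemma Z_L_grundy (G : sgraph) : Z_L G + gamma_gr_L G = #|G|.
Proof.
apply: (@forcing_number_grundy _ (@cnbh G)) => [x y|B x y].
  by rewrite !inE eq_sym adj_sym.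
rewrite /L_rule /skew_rule [_ \in cnbh _]inE in_set1 [y == x]eq_sym.
case: eqP => //= ->.
have /setDidPl-> // : [disjoint nbh y & [set y]].
by rewrite disjoint_sym disjoints1 inE adj_irr.
Qed.

(** * Exchange and reversal for open neighborhoods *)

Definition swap_rev (T : Type) (p : seq (T * T)) : seq (T * T) :=
  rev [seq (q.2, q.1) | q <- p].

Section TotalSequences.
Variable G : sgraph.
Implicit Types p : seq (G * G).

(** A repeated vertex would have its later footprint in its own earlier open neighborhood. *)
Lemma footprinted_uniq1 p : footprinted (@nbh G) p -> uniq (unzip1 p).
Proof.
case/andP=> Np; rewrite uniq_pairwise pairwise_map.
apply: (sub_in_pairwise _ Np) => q q' _ q'N /=.
by apply: contra => /eqP->.
Qed.

Lemma footprinted_swap_rev p :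
  footprinted (@nbh G) p -> footprinted (@nbh G) (swap_rev p).
Proof.
rewrite /swap_rev; elim: p => [//|[v w] p IHp] /=.
rewrite /footprinted /= => /andP[/andP[wv Np] /andP[vp Pp]].
rewrite rev_cons -/(footprinted _ _) footprinted_rcons IHp /=; last first.
  by rewrite /footprinted Np.
rewrite nbh_sym wv andbT all_rev all_map; apply: sub_all vp => q /=.
by rewrite nbh_sym.
Qed.

End TotalSequences.

(** * Total dominating sequences of [BL G] against L-sequences of [G] *)

Section BLGraph.
Variable G : sgraph.

Definition BL_x (i : G) : BL G := inl (inl i).
Definition BL_y (i : G) : BL G := inl (inr i).
Definition BL_z (i : G) : BL G := inr i.

Definition is_x (u : BL G) : bool := if u is inl (inl _) then true else false.

Definition BL_index (u : BL G) : G :=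
  match u with inl (inl i) | inl (inr i) | inr i => i end.

Lemma card_BL : #|BL G| = 3 * #|G|.
Proof. by rewrite !card_sum mulSn mul2n -addnn addnA. Qed.

Lemma nbh_BL_is_x (u w : BL G) : w \in nbh u -> is_x w = ~~ is_x u.
Proof. by rewrite inE; case: u => [[]|] i; case: w => [[]|]. Qed.

Lemma BL_y_nbh (i j : G) : (BL_y j \in nbh (BL_x i)) = (j \in cnbh i).
Proof. by rewrite !inE [LHS]orbF orbC eq_sym. Qed.

Lemma BL_z_nbh (i j : G) : (BL_z j \in nbh (BL_x i)) = (j \in nbh i).
Proof. by rewrite !inE [LHS]orbF. Qed.

Lemma BL_index_cnbh (u w : BL G) :
  is_x u -> w \in nbh u -> BL_index w \in cnbh (BL_index u).
Proof.
case: u => [[i|//]|//] _ wu; move: (nbh_BL_is_x wu).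
case: w wu => [[//|j]|j] + _; first by rewrite -BL_y_nbh.
by rewrite [_ \in _]BL_z_nbh => ji; rewrite in_setU ji orbT.
Qed.

Lemma BL_index_nbh (u w : BL G) :
  is_x u -> ~~ is_x w -> BL_index w \in nbh (BL_index u) -> w \in nbh u.
Proof.
case: u => [[i|//]|//] _; case: w => [[//|j]|j] _ /= ji.
  by rewrite [_ \in _]BL_y_nbh in_setU ji orbT.
by rewrite [_ \in _]BL_z_nbh.
Qed.

(** Forgetting the copy sends neighborhoods of x-vertices into closed ones, while open adjacency
    lifts to both the y- and z-copies; so avoiding earlier vertices survives projection. *)
Lemma footprinted_project (p : seq (BL G * BL G)) :
  footprinted (@nbh (BL G)) p -> all (fun q => is_x q.1) p ->
  size p <= gamma_gr_L G.
Proof.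
move=> Fp Xp; pose f (q : BL G * BL G) := (BL_index q.1, BL_index q.2).
rewrite -(size_map f); apply: size_footprinted_le.
  rewrite /unzip1 -map_comp (map_comp BL_index fst p : map (fst \o f) p = _).
  rewrite map_inj_in_uniq ?footprinted_uniq1 //.
  move=> u v /mapP[q qp ->] /mapP[q' q'p ->].
  move/allP: Xp => Xp; move: (Xp _ qp) (Xp _ q'p).
  by case: (q.1) => [[]|] // i _; case: (q'.1) => [[]|] // j _ /= ->.
case/andP: Fp => Np Pp.
have NXp : all (fun q => is_x q.1 && (q.2 \in nbh q.1)) p.
  by rewrite all_predI Xp.
rewrite /footprinted all_map pairwise_map; apply/andP; split.
  by apply: sub_all NXp => q /andP[]; apply: BL_index_cnbh.
apply: sub_in_pairwise NXp Pp => q q' /andP[Xq _] /andP[Xq' /nbh_BL_is_x].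
by rewrite Xq' => /negbT Xw'; apply: contra; apply: BL_index_nbh.
Qed.

Lemma gamma_gr_t_BL_le : gamma_gr_t (BL G) <= 2 * gamma_gr_L G.
Proof.
have [p [_ Fp szp]] := grundy_attained (@nbh (BL G)).
rewrite -[gamma_gr_t _]szp mul2n -addnn -(count_predC (fun q => is_x q.1)).
rewrite -!size_filter; apply: leq_add.
  apply: footprinted_project (filter_all _ _).
  exact: sub_footprinted (filter_subseq _ _) Fp.
set p' := filter _ _.
have Fp' : footprinted (@nbh (BL G)) p'.
  exact: sub_footprinted (filter_subseq _ _) Fp.
have -> : size p' = size (swap_rev p') by rewrite size_rev size_map.
apply: footprinted_project (footprinted_swap_rev Fp') _.
rewrite all_rev all_map; case/andP: Fp' => Np' _.
have : all (fun q => ~~ is_x q.1 && (q.2 \in nbh q.1)) p'.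
  by rewrite all_predI filter_all.
by apply: sub_all => q /andP[/= Xq /nbh_BL_is_x->].
Qed.

Lemma gamma_gr_t_BL_ge : 2 * gamma_gr_L G <= gamma_gr_t (BL G).
Proof.
have [p [Up Fp szp]] := grundy_attained (@cnbh G).
rewrite -[gamma_gr_L _]szp.
(* A vertex footprinting itself needs the y-copy, the only one adjacent to its [BL_x]. Any other
   footprint takes the z-copy, since it may itself be an earlier vertex. *)
pose f (q : G * G) := (BL_x q.1, if q.2 == q.1 then BL_y q.2 else BL_z q.2).
have Xp : all (fun q => is_x q.1 && ~~ is_x q.2) (map f p).
  by rewrite all_map; apply/allP => q _ /=; case: ifP.
have {Up} Ff : footprinted (@nbh (BL G)) (map f p).
  move: Fp Up; rewrite uniq_pairwise pairwise_map /footprinted.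
  case/andP=> Np Pp Up; rewrite all_map pairwise_map; apply/andP; split.
    apply: sub_all Np => -[i j] /=; case: eqP => [->|/eqP/negPf ji].
      by rewrite BL_y_nbh in_setU in_set1 eqxx.
    by rewrite BL_z_nbh in_setU in_set1 ji.
  have : pairwise [rel q q' : G * G | (q'.2 \notin nbh q.1) && (q.1 != q'.1)] p.
    by rewrite pairwise_relI Pp.
  apply: sub_pairwise => -[i j] [i' j'] /= /andP[ij' ii'].
  (* The y-copy sees closed neighborhoods, so distinctness of [i] and [i'] is used here. *)
  case: eqP => [j'i'|_]; last by rewrite BL_z_nbh.
  by rewrite BL_y_nbh in_setU in_set1 negb_or ij' j'i' eq_sym ii'.
have -> : 2 * size p = size (map f p ++ swap_rev (map f p)).
  by rewrite size_cat size_rev !size_map mul2n addnn.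
have Fs : footprinted (@nbh (BL G)) (map f p ++ swap_rev (map f p)).
  have /andP[N2 P2] := footprinted_swap_rev Ff; case/andP: Ff => N1 P1.
  rewrite /footprinted all_cat N1 N2 pairwise_cat P1 P2 !andbT /=.
  (* Across the two halves, the earlier vertex and the later footprint are both x-vertices, hence
     not adjacent. *)
  apply/allrelP => q q' /(allP Xp)/andP[Xq _].
  rewrite mem_rev => /mapP[r /(allP Xp)/andP[Xr _] ->] /=.
  by apply/negP => /nbh_BL_is_x; rewrite Xq Xr.
exact: size_footprinted_le (footprinted_uniq1 Fs) Fs.
Qed.

End BLGraph.

Theorem theorem4p3 (G : sgraph) (n : nat) (card_G : #|G| = n) :
  Z_skew (BL G) = n + 2 * Z_L G /\ gamma_gr_t (BL G) = 2 * gamma_gr_L G.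
Proof.
have gE : gamma_gr_t (BL G) = 2 * gamma_gr_L G.
  by apply/eqP; rewrite eqn_leq gamma_gr_t_BL_le gamma_gr_t_BL_ge.
(* With the total Grundy number added, both sides equal [3 * n]. *)
split=> //; apply/eqP; rewrite -(eqn_add2r (gamma_gr_t (BL G))).
by rewrite Z_skew_grundy card_BL gE -addnA -mulnDr Z_L_grundy card_G mulSn.
Qed.
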